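(* Let $q=p^e$ be a prime power ($p$ prime), $m\geq5$, $\ell\geq1$, $F=\mathbb{F}_{q^m}$. Fix a maximum scattered $q$-system $W\leq F^{2\ell}$ and let $s$ be an integer with $1\leq s<(m-2)/2$. Then among the systems $U_\varphi$ constructed from $W$ (see context) for which the independence condition $\dim_{\mathbb{F}_q}\overline E_Z=s$ holds, there are at least $$\left\lceil\frac{\genfrac{[}{]}{0pt}{}{\ell m}{s}_{q}}{em\,|\operatorname{GL}(2\ell,F)|}\right\rceil$$ pairwise inequivalent extremal $(m-3)$-scattered $q$-systems.
   Context: The Gaussian coefficient is $\genfrac{[}{]}{0pt}{}{N}{s}_{q}=\prod_{i=0}^{s-1}\frac{q^{N-i}-1}{q^{s-i}-1}$. Systems. An $[n,k]_{q^m/q}$ $q$-system is an $n$-dimensional $\mathbb{F}_q$-subspace $U\leq F^k$ with $\langle U\rangle_F=F^k$; $n$ is its rank. It is $h$-scattered if $\dim_{\mathbb{F}_q}(U\cap H)\leq h$ for every $h$-dimensional $F$-subspace $H\leq F^k$; an $h$-scattered system is extremal if $n=\lfloor km/(h+1)\rfloor$. A maximum scattered system in $F^{2\ell}$ is a $1$-scattered $q$-system of rank $\ell m$. Two systems $U,U'$ in $F^k$ are equivalent if $U'=B(\sigma(U))$ for some $B\in\operatorname{GL}(k,F)$ and $\sigma\in\operatorname{Aut}(F)$, the full field automorphism group of $F$ (of order $em$). Construction. Put $n_0=\ell m$, $k_0=\ell(m-2)$. Choose an ordered $\mathbb{F}_q$-basis of $W$ as the columns of $H_0\in F^{2\ell\times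 n_0}$, let $D_0$ be the $F$-row space of $H_0$, choose a generator matrix $G_0\in F^{k_0\times n_0}$ of $D_0^\perp=\{y\in F^{n_0}:xy^\top=0\ \forall x\in D_0\}$ with columns $g_1,\ldots,g_{n_0}$ (these are $\mathbb{F}_q$-independent), and let $U_0\leq F^{k_0}$ be their $\mathbb{F}_q$-span. For an $\mathbb{F}_q$-linear map $\varphi:U_0\to F^s$ define $$U_\varphi=\{(u,\varphi(u)+a):u\in U_0,\ a\in\mathbb{F}_q^s\}\leq F^{k_0+s},$$ $\Phi=[\varphi(g_1)\ \cdots\ \varphi(g_{n_0})]\in F^{s\times n_0}$, and $Z=-H_0\Phi^\top\in F^{2\ell\times s}$. If $z_1,\ldots,z_s$ are the columns of $Z$, put $\overline E_Z=\langle z_1+W,\ldots,z_s+W\rangle_{\mathbb{F}_q}\leq F^{2\ell}/W$. *)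

(* Defs.v *)
From HB Require Import structures.
From mathcomp Require Import all_boot all_order all_algebra all_field.

Set Implicit Arguments.
Unset Strict Implicit.
Unset Printing Implicit Defensive.

Import GRing.Theory VectorInternalTheory.

Local Open Scope ring_scope.

(* Throughout, K = F_q and F = F_(q^m) is an extension of K of degree
   m = \dim {:F}. The type 'cV[F]_k is F^k as an F-vector space, so that
   {vspace 'cV[F]_k} consists of F-subspaces. The alias colvec F k is F^k as a
   K-vector space (restriction of scalars), so that {vspace (colvec F k)}
   consists of K-subspaces and \dim is then the dimension over K. *)
Definition colvec (K : fieldType) (F : fieldExtType K) (k : nat) : Type :=
  'cV[F]_k.

Section ColvecVectType.
Variables (K : fieldType) (F : fieldExtType K) (k : nat).
Local Notation V := (colvec F k).

HB.instance Definition _ := GRing.Zmodule.copy V 'cV[F]_k.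

Definition colvec_scale (a : K) (v : V) : V := a%:A *: (v : 'cV[F]_k).

Fact colvec_scaleA a b v :
  colvec_scale a (colvec_scale b v) = colvec_scale (a * b) v.
Proof. by rewrite /colvec_scale scalerA mulr_algl scalerA. Qed.

Fact colvec_scale1 : left_id 1 colvec_scale.
Proof. by move=> v; rewrite /colvec_scale !scale1r. Qed.

Fact colvec_scaleDr : right_distributive colvec_scale +%R.
Proof. by move=> a u v; apply: (@scalerDr F 'cV[F]_k). Qed.

Fact colvec_scaleDl v : {morph colvec_scale^~ v : a b / a + b}.
Proof. by move=> a b; rewrite /colvec_scale !scalerDl. Qed.

HB.instance Definition _ := GRing.Zmodule_isLmodule.Build K V
  colvec_scaleA colvec_scale1 colvec_scaleDr colvec_scaleDl.

Lemma colvec_scaleE (a : K) (v : V) : a *: v = a%:A *: (v : 'cV[F]_k).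
Proof. by []. Qed.

Fact colvec_vect_iso : Vector.axiom (k * dim F) V.
Proof.
pose f (v : V) := mxvec (\matrix_(i < k) v2r ((v : 'cV[F]_k) i 0)).
pose g r : V := \col_i r2v (row i (vec_mx r : 'M[K]_(k, dim F))).
exists f.
  move=> a u v; rewrite -linearP; congr mxvec; apply/matrixP=> i j.
  by rewrite !mxE mulr_algl linearP !mxE.
exists g => [v|r].
  by apply/matrixP=> i j; rewrite mxE mxvecK rowK v2rK (ord1 j).
by apply/(canLR vec_mxK)/matrixP=> i j; rewrite mxE mxE r2vK mxE.
Qed.

HB.instance Definition _ := Lmodule_hasFinDim.Build K V colvec_vect_iso.

End ColvecVectType.

(* An F-subspace H of F^k, regarded as a K-subspace. *)
Definition restrict_scalars (K : fieldType) (F : fieldExtType K) (k : nat)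
    (H : {vspace 'cV[F]_k}) : {vspace (colvec F k)} :=
  limg (linfun (fun v : colvec F k => projv H v : colvec F k)).

Lemma mem_restrict_scalars (K : fieldType) (F : fieldExtType K) (k : nat)
    (H : {vspace 'cV[F]_k}) (v : 'cV[F]_k) :
  ((v : colvec F k) \in restrict_scalars H) = (v \in H).
Proof.
pose f (v : colvec F k) := projv H v : colvec F k.
have fL : linear f by move=> a x y; apply: (linearP (projv H)).
pose fM := GRing.isLinear.Build _ _ _ _ f fL.
pose fl : {linear colvec F k -> colvec F k} := HB.pack f fM.
have fE x : linfun f x = projv H x by apply: (lfunE fl).
apply/memv_imgP/idP => [[u _ ->]|vH]; first by rewrite fE memv_proj.
by exists v; rewrite ?memvf // fE projv_id.
Qed.

(* The two conditions of the definition of an [n, k]_(q^m/q) q-system; the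
   second one says that no proper F-subspace of F^k contains U. *)
Definition is_qsystem (K : fieldType) (F : fieldExtType K) (k n : nat)
    (U : {vspace (colvec F k)}) : Prop :=
  \dim U = n /\
  (forall H : {vspace 'cV[F]_k}, (U <= restrict_scalars H)%VS -> H = fullv).

Definition is_scattered (K : fieldType) (F : fieldExtType K) (k h : nat)
    (U : {vspace (colvec F k)}) : Prop :=
  forall H : {vspace 'cV[F]_k},
    \dim H = h -> (\dim (U :&: restrict_scalars H) <= h)%N.

Definition extremal_scattered (K : fieldType) (F : fieldExtType K) (k h : nat)
    (U : {vspace (colvec F k)}) : Prop :=
  is_qsystem ((k * \dim {:F}) %/ h.+1) U /\ is_scattered h U.

Definition maximum_scattered (K : fieldType) (F : fieldExtType K) (l : nat)
    (W : {vspace (colvec F (2 * l))}) : Prop :=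
  is_qsystem (l * \dim {:F}) W /\ is_scattered 1 W.

(* U' = B(sigma(U)); sigma is an arbitrary field automorphism of F, not
   required to fix K. *)
Definition equivalent_systems (K : fieldType) (F : fieldExtType K) (k : nat)
    (U U' : {vspace (colvec F k)}) : Prop :=
  exists (B : 'M[F]_k) (sigma : {rmorphism F -> F}),
    [/\ B \in unitmx, bijective sigma &
        forall v : 'cV[F]_k, (v : colvec F k) \in U' <->
          exists2 u : 'cV[F]_k, (u : colvec F k) \in U &
            v = B *m map_mx sigma u].

Definition columns (K : fieldType) (F : fieldExtType K) (k n : nat)
    (A : 'M[F]_(k, n)) : n.-tuple (colvec F k) :=
  [tuple (col j A : colvec F k) | j < n].

(* G is a generator matrix of the orthogonal D^⊥ of the row space D of H. *)
Definition generates_dual (F : fieldType) (r k n : nat)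
    (H : 'M[F]_(r, n)) (G : 'M[F]_(k, n)) : Prop :=
  row_free G /\
  (forall y : 'rV[F]_n,
     (y <= G)%MS <->
     (forall x : 'rV[F]_n, (x <= H)%MS -> x *m y^T = 0)).

Definition column_span (K : fieldType) (F : fieldExtType K) (k n : nat)
    (G : 'M[F]_(k, n)) : {vspace (colvec F k)} := <<columns G>>%VS.

(* U_phi is the image of U0 x K^s under the K-linear map
   (u, a) |-> (u, phi(u) + a). *)
Definition U_phi_map (K : fieldType) (F : fieldExtType K) (k s : nat)
    (U0 : {vspace (colvec F k)}) (phi : 'Hom(subvs_of U0, colvec F s))
    (x : subvs_of U0 * 'cV[K]_s) : colvec F (k + s) :=
  col_mx (vsval x.1 : 'cV[F]_k)
         ((phi x.1 : 'cV[F]_s) + map_mx (in_alg F) x.2).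

Definition U_phi (K : fieldType) (F : fieldExtType K) (k s : nat)
    (U0 : {vspace (colvec F k)}) (phi : 'Hom(subvs_of U0, colvec F s)) :
    {vspace (colvec F (k + s))} :=
  limg (linfun (U_phi_map phi)).

Fact U_phi_map_linear (K : fieldType) (F : fieldExtType K) (k s : nat)
    (U0 : {vspace (colvec F k)}) (phi : 'Hom(subvs_of U0, colvec F s)) :
  linear (U_phi_map phi).
Proof.
move=> a [u b] [v c]; rewrite /U_phi_map /= (linearP phi).
rewrite [RHS](_ : _ = a%:A *:
    col_mx (vsval u : 'cV[F]_k) ((phi u : 'cV[F]_s) + map_mx (in_alg F) b) +
    col_mx (vsval v : 'cV[F]_k) ((phi v : 'cV[F]_s) + map_mx (in_alg F) c)) //.
rewrite scale_col_mx add_col_mx; congr col_mx.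
rewrite scalerDr addrACA map_mxD; congr (_ + (_ + _)).
by apply/matrixP=> i j; rewrite !mxE /= mulr_algl scalerA.
Qed.

Lemma mem_U_phi (K : fieldType) (F : fieldExtType K) (k s : nat)
    (U0 : {vspace (colvec F k)}) (phi : 'Hom(subvs_of U0, colvec F s))
    (v : 'cV[F]_(k + s)) :
  (v : colvec F (k + s)) \in U_phi phi <->
  exists (u : subvs_of U0) (a : 'cV[K]_s),
    v = col_mx (vsval u : 'cV[F]_k)
               ((phi u : 'cV[F]_s) + map_mx (in_alg F) a).
Proof.
pose fM := GRing.isLinear.Build _ _ _ _ _ (U_phi_map_linear phi).
pose fl : {linear _ -> _} := HB.pack (U_phi_map phi) fM.
have fE x : linfun (U_phi_map phi) x = U_phi_map phi x by apply: (lfunE fl).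
split=> [/memv_imgP[[u a] _ ->]|[u [a ->]]]; first by exists u, a; rewrite fE.
by apply/memv_imgP; exists (u, a); rewrite ?memvf // fE.
Qed.

Definition Phi_mx (K : fieldType) (F : fieldExtType K) (k n s : nat)
    (G : 'M[F]_(k, n)) (phi : 'Hom(subvs_of (column_span G), colvec F s)) :
    'M[F]_(s, n) :=
  \matrix_(i, j) (phi (vsproj _ (col j G : colvec F k)) : 'cV[F]_s) i 0.

Definition Z_mx (K : fieldType) (F : fieldExtType K) (r k n s : nat)
    (H : 'M[F]_(r, n)) (G : 'M[F]_(k, n))
    (phi : 'Hom(subvs_of (column_span G), colvec F s)) : 'M[F]_(r, s) :=
  - (H *m (Phi_mx phi)^T).

(* The quotient V / W, realized on the complement W^C; quotv_proj is the
   canonical surjection v |-> v + W, with kernel W. *)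
Definition quotv (K : fieldType) (V : vectType K) (W : {vspace V}) :
  vectType K := subvs_of (W^C)%VS.

Definition quotv_proj (K : fieldType) (V : vectType K) (W : {vspace V}) :
    'Hom(V, quotv W) :=
  linfun (fun v : V => vsproj (W^C)%VS (daddv_pi (W^C)%VS W v)).

Lemma quotv_projE (K : fieldType) (V : vectType K) (W : {vspace V}) (v : V) :
  quotv_proj W v = vsproj (W^C)%VS (daddv_pi (W^C)%VS W v).
Proof.
pose f (v : V) := vsproj (W^C)%VS (daddv_pi (W^C)%VS W v).
have fL : linear f by move=> a x y; rewrite /f !linearP.
pose fM := GRing.isLinear.Build _ _ _ _ f fL.
pose fl : {linear _ -> _} := HB.pack f fM.
exact: (lfunE fl).
Qed.

Lemma limg_quotv_proj (K : fieldType) (V : vectType K) (W : {vspace V}) :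
  limg (quotv_proj W) = fullv.
Proof.
have dCW : (W^C :&: W = 0)%VS by rewrite capvC capv_compl.
apply/eqP; rewrite eqEsubv subvf; apply/subvP=> u _.
apply/memv_imgP; exists (vsval u); rewrite ?memvf // quotv_projE.
by rewrite daddv_pi_id ?subvsP // vsvalK.
Qed.

Lemma lker_quotv_proj (K : fieldType) (V : vectType K) (W : {vspace V}) :
  lker (quotv_proj W) = W.
Proof.
have dCW : (W^C :&: W = 0)%VS by rewrite capvC capv_compl.
have dWC : (W :&: W^C = 0)%VS by rewrite capv_compl.
apply/vspaceP=> v; rewrite memv_ker quotv_projE.
have vCW : v \in (W^C + W)%VS by rewrite addvC addv_complf memvf.
have vE := daddv_pi_add dCW vCW.
apply/eqP/idP => [/(congr1 vsval)|vW].
  rewrite vsprojK ?memv_pi // linear0 => v0.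
  by rewrite -vE v0 add0r memv_pi.
move: vE; rewrite (daddv_pi_id dWC vW) -[RHS]add0r => /addIr ->.
by rewrite linear0.
Qed.

Definition E_bar (K : fieldType) (F : fieldExtType K) (r s : nat)
    (W : {vspace (colvec F r)}) (Z : 'M[F]_(r, s)) : {vspace (quotv W)} :=
  <<[seq quotv_proj W z | z <- columns Z]>>%VS.

Definition gaussian_coef (q N s : nat) : rat :=
  \prod_(i < s) ((q%:R ^+ (N - i) - 1) / (q%:R ^+ (s - i) - 1)).

(* Main.v *)
Require Import Defs.
From HB Require Import structures.
From mathcomp Require Import all_boot all_order all_algebra all_field.
From mathcomp Require Import fingroup cyclic mxabelem ring zify.

Set Implicit Arguments.
Unset Strict Implicit.
Unset Printing Implicit Defensive.

Import Order.TTheory GRing.Theory Num.Theory.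

Local Open Scope ring_scope.

(** U_phi is treated through a parity check matrix. Let N = lm. The columns of
    (G0, 0 ; Phi, 1) form an F_q-basis of U_phi, and (H0 | Z), with
    Z = - H0 Phi^T, generates over F the dual of the code generated by that
    matrix.

    Scatteredness. U_phi is (m-3)-scattered as soon as every nonzero word of the
    dual code has rank weight at least m - 1 over F_q. The first block of such a
    word is x H0, so it suffices to know this for H0, that is, to know that a
    hyperplane meets W in F_q-dimension at most N - m + 1
    ([hyperplane_weight]). This is a second moment computation: W is scattered,
    so pairs of F_q-independent vectors of W are F-independent and the numbers
    of hyperplanes through them are known. The rank N + s is the extremal value
    because 2s < m - 2 ([U_phi_extremal]).

    Counting. Since H0 has rank 2l, every Z arises from some phi. Fix a
    complement of W in F^(2l), of dimension N over F_q; the s-dimensional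
    subspaces of the complement, given by row-free s x N matrices A over F_q up
    to GL_s(F_q), provide the systems. If U_phi and U_phi' are equivalent, then
    by duality the F_q-span E' of the columns of (H0 | Z') is the image of the
    corresponding span E under a matrix B of GL(2l, F) and an automorphism of F
    ([equivalent_parity_checks]). As F has em automorphisms, a given A is
    equivalent to at most em |GL(2l, F)| |GL_s(F_q)| matrices
    ([card_neighbours]). A greedy choice ([greedy_packing]) then leaves at least
    (number of row-free matrices) / (em |GL(2l, F)| |GL_s(F_q)|) inequivalent
    systems, and the quotient of the two counts over F_q is the Gaussian
    coefficient ([gaussian_coefE]).

    Throughout, ext A is a matrix A over K viewed over F. *)

(** * Counting and finite fields *)

Lemma rank_col_mx_row (K : fieldType) s n (u : 'rV[K]_n) (A : 'M[K]_(s, n)) :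
  \rank (col_mx u A) = (\rank A + ~~ (u <= A)%MS)%N.
Proof.
have := mxrank_sum_cap u A; rewrite -addsmxE.
have [uA|nuA] := boolP (u <= A)%MS.
  by move=> _; rewrite addn0 (addsmx_idPr uA).
rewrite (_ : \rank (u :&: A)%MS = 0)%N; first last.
  apply/eqP; rewrite mxrank_eq0; apply: contraNT nuA => nz.
  apply: submx_trans (capmxSr u A).
  rewrite -(mxrank_leqif_sup (capmxSl u A)).2 eqn_leq mxrankS ?capmxSl //=.
  by apply: leq_trans (rank_leq_row u) _; rewrite lt0n mxrank_eq0.
rewrite addn0 addnC => ->; congr (_ + _)%N; apply/eqP.
rewrite eqn_leq rank_leq_row lt0n mxrank_eq0.
by apply: contraNneq nuA => ->; rewrite sub0mx.
Qed.

Lemma row_free_col_mx (K : fieldType) s n (u : 'rV[K]_n) (A : 'M[K]_(s, n)) :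
  row_free (col_mx u A) = row_free A && ~~ (u <= A)%MS.
Proof.
rewrite /row_free rank_col_mx_row; have := rank_leq_row A.
by case: (_ <= _)%MS; rewrite ?andbT ?andbF; lia.
Qed.

Lemma row_free_row_mx (K : fieldType) r n s (H : 'M[K]_(r, n))
    (Z : 'M[K]_(r, s)) :
  row_free H -> row_free (row_mx H Z).
Proof.
move=> /row_freeP[B HB]; apply/row_freeP; exists (col_mx B 0).
by rewrite mul_row_col HB mulmx0 addr0.
Qed.

Lemma rank_of_injective (K : fieldType) n r (M : 'M[K]_(n, r)) :
  (forall y : 'cV_r, M *m y = 0 -> y = 0) -> \rank M = r.
Proof.
move=> injM; apply/eqP; rewrite -mxrank_tr -/(row_free _) -kermx_eq0.
apply/eqP/row_matrixP=> i; rewrite row0; apply: trmx_inj; rewrite trmx0.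
apply: injM; have := congr1 trmx (row_mul i (kermx M^T) M^T).
by rewrite mulmx_ker row0 trmx0 trmx_mul trmxK.
Qed.

Lemma injective_of_rank (K : fieldType) n r (M : 'M[K]_(n, r)) p
    (y : 'M_(r, p)) :
  \rank M = r -> M *m y = 0 -> y = 0.
Proof.
move=> rM My0; have fM : row_free M^T by rewrite /row_free mxrank_tr rM.
apply: trmx_inj; apply: (row_free_inj fM).
by rewrite trmx0 mul0mx -trmx_mul My0 trmx0.
Qed.

(** The matrix is built row by row: a row may be stacked on A exactly when it
    avoids the row space of A, which has #|K| ^ i elements when A has i rows. *)
Lemma card_row_free (K : finFieldType) s n :
  #|[set A : 'M[K]_(s, n) | row_free A]| =
    (\prod_(i < s) (#|K| ^ n - #|K| ^ i))%N.
Proof.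
elim: s => [|s IHs].
  rewrite big_ord0 (_ : [set _ | _] = [set 0]) ?cards1 //.
  by apply/setP=> A; rewrite !inE flatmx0 /row_free mxrank0 !eqxx.
rewrite big_ord_recr /= -IHs -sum_nat_const /=.
rewrite -sum1dep_card (partition_big (@dsubmx _ 1 s n)
  (fun A => A \in [set A | row_free A])) /=; last first.
  move=> A; rewrite inE -{1}(@vsubmxK _ 1 s n A) row_free_col_mx.
  by case/andP.
apply: eq_bigr => A; rewrite inE => fA.
rewrite (reindex (fun u : 'rV[K]_n => col_mx u A)) /=; last first.
  exists (@usubmx _ 1 s n) => [u _|B]; first by rewrite col_mxKu.
  by case/andP=> _ /eqP <-; rewrite vsubmxK.
rewrite (eq_bigl (fun u => u \notin rowg A)); last first.
  by move=> u; rewrite col_mxKd eqxx andbT row_free_col_mx fA inE.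
rewrite sum1_card (_ : (#|K| ^ n)%N = #|{: 'rV[K]_n}|); last first.
  by rewrite card_mx mul1n.
rewrite (_ : (#|K| ^ s)%N = #|rowg A|); last by rewrite card_rowg (eqnP fA).
by rewrite -(cardC (mem (rowg A))) addKn; apply: eq_card.
Qed.

Lemma card_unitmx (K : finFieldType) n : (0 < n)%N ->
  #|[set A : 'M[K]_n | A \in unitmx]| = #|'GL_n[K]%g|.
Proof. by case: n => // n _; rewrite cardsT /= card_sub cardsE. Qed.

(** An s-dimensional subspace of K^N is a row-free s x N matrix up to GL_s(K),
    so the Gaussian coefficient is a quotient of two counts of row-free
    matrices; the common factors q^i of the two products cancel. *)
Lemma gaussian_coefE (q N s : nat) : (1 < q)%N -> (s <= N)%N ->
  gaussian_coef q N s * (\prod_(i < s) (q ^ s - q ^ i))%N%:R =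
    (\prod_(i < s) (q ^ N - q ^ i))%N%:R.
Proof.
move=> q_gt1 sN; rewrite /gaussian_coef !natr_prod -big_split /=.
have E k (i : 'I_s) : (s <= k)%N ->
  ((q ^ k - q ^ i)%N%:R : rat) = q%:R ^+ i * (q%:R ^+ (k - i) - 1).
  move=> sk; have ik : (i <= k)%N by apply: leq_trans sk; apply: ltnW.
  have qik : (q ^ i <= q ^ k)%N by rewrite leq_exp2l.
  by rewrite (natrB _ qik) !natrX -{1}(subnKC ik) exprD mulrBr mulr1.
apply: eq_bigr => i _; rewrite !E // mulrCA mulfVK // subr_eq0.
rewrite -natrX -[1]/(1%:R) eqr_nat neq_ltn.
by rewrite orbC -{1}(expn0 q) ltn_exp2l // subn_gt0 ltn_ord.
Qed.

(** Choose an element, discard its neighbourhood, and repeat: each choice costs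
    at most M elements of X. Symmetry of E is what makes an element chosen later
    unrelated in both directions to those chosen before. *)
Lemma greedy_packing (T : finType) (E : T -> T -> Prop) (Nb : T -> {set T}) M
    (X : {set T}) :
    (forall x y, E x y -> E y x) -> {in X, forall x, x \in Nb x} ->
    {in X &, forall x y, E x y -> y \in Nb x} ->
    {in X, forall x, #|Nb x| <= M}%N ->
  exists r (f : 'I_r -> T), [/\ #|X| <= r * M, forall i, f i \in X &
    forall i j, i != j -> ~ E (f i) (f j)]%N.
Proof.
move=> symE; have [n] := ubnP #|X|; elim: n X => // n IHn X Xn NbX NbE NbM.
have [->|[x xX]] := set_0Vmem X.
  have f0 : 'I_0 -> T by case.
  by exists 0%N, f0; rewrite cards0; split=> // -[].
pose Y := X :\: Nb x.
have YX y : y \in Y -> y \in X by rewrite inE => /andP[].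
have Yn : (#|Y| < n)%N.
  rewrite -ltnS; apply: leq_trans Xn; rewrite ltnS proper_card //.
  rewrite properEneq subsetDl andbT; apply/negP=> /eqP/setP/(_ x).
  by rewrite !inE NbX // xX.
have [|||r [f [cY fY fE]]] := IHn Y Yn.
- by move=> y /YX; apply: NbX.
- by move=> y z /YX yX /YX zX; apply: NbE.
- by move=> y /YX; apply: NbM.
exists r.+1, (fun i => if unlift ord0 i is Some j then f j else x); split.
- rewrite mulSn -(cardsID (Nb x) X) leq_add //.
  by apply: leq_trans (NbM x xX); rewrite subset_leq_card ?subsetIr.
- by move=> i; case: unliftP => [j _|_] //; apply/YX/fY.
have nE j : ~ E x (f j).
  by move/(NbE _ _ xX (YX _ (fY j))) => h; case/setDP: (fY j); rewrite h.
move=> i j; case: unliftP => [i' ->|->]; case: unliftP => [j' ->|->] //.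
- by rewrite (inj_eq lift_inj); apply: fE.
- by move=> _ /symE; apply: nE.
Qed.

(** Let z generate the multiplicative group. The product of the X - z^(p^j), for
    j < n, is permuted into itself by the Frobenius map, so its coefficients lie
    in the prime field and are fixed by sigma. Hence sigma sends the root z to
    another root z^(p^j), and sigma is x |-> x^(p^j) on all powers of z. *)
Lemma finField_rmorphism_frobenius (L : finFieldType) p n
    (sigma : {rmorphism L -> L}) : prime p -> #|L| = (p ^ n)%N ->
  exists j : 'I_n, forall x, sigma x = x ^+ (p ^ j).
Proof.
move=> p_pr cardL; have pL := card_finPcharP cardL p_pr.
have n_gt0 : (0 < n)%N.
  rewrite lt0n; apply: contraTneq (finNzRing_gt1 L) => n0.
  by rewrite cardL n0.
pose phi : {rmorphism L -> L} := pFrobenius_aut pL.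
(* X^p - X has at most p roots, and the p multiples of 1 are roots, so an
   element fixed by Frobenius is a multiple of 1. *)
have fixed c : c ^+ p = c -> sigma c = c.
  move=> cp; have [|nc] := boolP (c \in [seq (nat_of_ord k)%:R | k : 'I_p]).
    by case/imageP=> k _ ->; rewrite rmorph_nat.
  pose rs := c :: [seq (nat_of_ord k)%:R | k : 'I_p] : seq L.
  have P0 : 'X^p - 'X != 0 :> {poly L}.
    by rewrite -size_poly_eq0 size_polyDl ?size_polyXn // size_polyN size_polyX
      ltnS prime_gt1.
  have rP : all (root ('X^p - 'X)) rs.
    apply/allP=> x; rewrite inE rootE !hornerE subr_eq0.
    case/predU1P=> [->|/imageP[k _ ->]]; first by rewrite cp.
    by rewrite -(pFrobenius_autE pL) rmorph_nat.
  have rU : uniq rs.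
    rewrite /= nc map_inj_uniq ?enum_uniq //.
    suff le_inj k k' : k%:R = k'%:R :> L -> (k <= k' < p)%N -> k = k'.
      move=> k k' kk; apply: val_inj => /=; have [kk'|/ltnW k'k] := leqP k k'.
        by apply: le_inj; rewrite // kk' ltn_ord.
      by apply/esym/le_inj; rewrite // k'k ltn_ord.
    move=> kk /andP[kk' k'p]; apply/eqP; rewrite eqn_leq kk' -subn_eq0 /=.
    have : (p %| k' - k)%N by rewrite (dvdn_pcharf pL) natrB // kk subrr.
    rewrite /dvdn modn_small //; exact: leq_ltn_trans (leq_subr _ _) k'p.
  have := max_poly_roots P0 rP rU.
  rewrite /= size_image card_ord size_polyDl ?size_polyXn ?ltnn //.
  by rewrite size_polyN size_polyX ltnS prime_gt1.
have /cyclicP[z Dz] := field_unit_group_cyclic [set: {unit L}]%G.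
pose P := \prod_(j < n) ('X - (FinRing.uval z ^+ (p ^ j))%:P).
have PF : map_poly phi P = P.
  rewrite /P rmorph_prod; case: (n) n_gt0 cardL => // n' _ cardL.
  rewrite big_ord_recr [RHS]big_ord_recl mulrC /=; congr (_ * _).
    apply: eq_bigr => j _; rewrite rmorphB /= map_polyX map_polyC /=.
    by rewrite pFrobenius_autE -exprM -expnSr.
  rewrite rmorphB /= map_polyX map_polyC /= pFrobenius_autE -exprM -expnSr.
  by rewrite -cardL expf_card expn0 expr1.
have Ps : map_poly sigma P = P.
  apply/polyP=> i; rewrite coef_map /= fixed // -(pFrobenius_autE pL).
  by rewrite -/phi -coef_map PF.
have : P.[sigma (FinRing.uval z)] == 0.
  rewrite -Ps horner_map /= fmorph_eq0 /P horner_prod prodf_seq_eq0.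
  apply/hasP; exists (Ordinal n_gt0); first by rewrite mem_index_enum.
  by rewrite !hornerE expn0 expr1 subrr.
rewrite /P horner_prod prodf_seq_eq0 => /hasP[j _].
rewrite !hornerE subr_eq0 => /eqP sz; exists j => x.
have [->|x0] := eqVneq x 0; first by
  rewrite rmorph0 expr0n expn_eq0 eqn0Ngt prime_gt0.
have : finField_unit x0 \in [set: {unit L}]%G by rewrite inE.
rewrite Dz => /cycleP[k] /(congr1 FinRing.uval).
rewrite FinRing.val_unitX /= => ->.
by rewrite rmorphXn /= sz -!exprM mulnC.
Qed.

(** * Coordinates over the base field *)

Section Coordinates.

Variables (K : fieldType) (F : fieldExtType K).

Local Notation ext A := (map_mx (in_alg F) A).

Lemma nth_columns k n (G : 'M[F]_(k, n)) (j : 'I_n) :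
  (columns G)`_j = (col j G : colvec F k).
Proof. by rewrite -tnth_nth tnth_mktuple. Qed.

Lemma mulmx_ext k n (G : 'M[F]_(k, n)) (y : 'cV[K]_n) :
  (G *m ext y : colvec F k) = \sum_j y j 0 *: (columns G)`_j.
Proof.
apply/matrixP=> i j; rewrite ord1 [in LHS]mxE.
rewrite [RHS](summxE _ _ (fun j => (y j 0)%:A *: (columns G)`_j : 'cV_k)).
apply: eq_bigr => {}j _; rewrite [X in _ * X]mxE [RHS]mxE mulrC.
by rewrite nth_columns mxE.
Qed.

(** Membership in a K-span as a matrix equation: ext y is a vector over F with
    entries in K. *)
Lemma mem_column_span k n (G : 'M[F]_(k, n)) (v : 'cV[F]_k) :
  reflect (exists y : 'cV[K]_n, v = G *m ext y)
          ((v : colvec F k) \in column_span G).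
Proof.
apply: (iffP idP) => [vG|[y ->]].
  exists (\col_j coord (columns G) j (v : colvec F k)).
  rewrite mulmx_ext {1}(coord_span vG).
  by apply: eq_bigr => j _; rewrite [in RHS]mxE.
rewrite mulmx_ext; apply: memv_suml => j _; apply/memvZ/memv_span.
exact/mem_nth/(leq_trans (ltn_ord j))/eq_leq/esym/size_tuple.
Qed.

Lemma col_column_span k n (G : 'M[F]_(k, n)) j :
  (col j G : colvec F k) \in column_span G.
Proof. by apply/memv_span/tnthP; exists j; rewrite tnth_mktuple. Qed.

Lemma free_columnsP k n (G : 'M[F]_(k, n)) :
  reflect (forall y : 'cV[K]_n, G *m ext y = 0 -> y = 0) (free (columns G)).
Proof.
apply: (iffP freeP) => [fG y Gy0|fG c c0 i].
  apply/matrixP=> i j; rewrite ord1 [RHS]mxE.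
  by apply: (fG (fun i => y i 0)); rewrite -mulmx_ext.
have /fG/(congr1 (fun M : 'cV_n => M i 0)) : G *m ext (\col_i c i) = 0.
  by rewrite [LHS]mulmx_ext -[RHS]c0; apply: eq_bigr => j _; rewrite mxE.
by rewrite !mxE.
Qed.

Lemma mulmx_ext_eq0 k n r (G : 'M[F]_(k, n)) (Y : 'M[K]_(n, r)) :
  free (columns G) -> G *m ext Y = 0 -> Y = 0.
Proof.
move=> /free_columnsP fG GY; apply/matrixP=> i j.
have /fG/matrixP/(_ i 0) : G *m ext (col j Y) = 0.
  by rewrite map_col colE mulmxA GY mul0mx.
by rewrite !mxE.
Qed.

Lemma dim_column_span k n (G : 'M[F]_(k, n)) :
  free (columns G) -> \dim (column_span G) = n.
Proof. by rewrite /free size_tuple => /eqP. Qed.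

Lemma column_span_factor k n r (G : 'M[F]_(k, n)) (T : 'M[F]_(k, r)) :
  (forall j, (col j T : colvec F k) \in column_span G) ->
  exists Y : 'M[K]_(n, r), T = G *m ext Y.
Proof.
move=> TG; have /(fin_all_exists) [y Dy] j := mem_column_span _ _ (TG j).
exists (\matrix_(i, j) y j i 0); apply/matrixP=> i j.
have := congr1 (fun M : 'cV_k => M i 0) (Dy j); rewrite !mxE => ->.
by apply: eq_bigr => h _; rewrite !mxE.
Qed.

End Coordinates.

(** * Hyperplane sections of a maximum scattered system *)

Lemma card_left_kernel (K : finFieldType) k r (B : 'M[K]_(k, r)) :
  #|[set x : 'rV[K]_k | x *m B == 0]| = (#|K| ^ (k - \rank B))%N.
Proof.
by rewrite -mxrank_ker -card_rowg; apply: eq_card => x; rewrite !inE sub_kermx.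
Qed.

Lemma card_right_kernel (K : finFieldType) k r (B : 'M[K]_(r, k)) :
  #|[set x : 'cV[K]_k | B *m x == 0]| = (#|K| ^ (k - \rank B))%N.
Proof.
rewrite -(mxrank_tr B) -card_left_kernel -(card_imset _ trmx_inj).
apply: eq_card => x; rewrite inE; apply/imsetP/eqP => [[y + ->]|xB].
  by rewrite inE -trmx_mul => /eqP->; rewrite trmx0.
by exists x^T; rewrite ?trmxK // inE -(trmxK B) -trmx_mul xB trmx0.
Qed.

Section HyperplaneWeights.

Variables (K : finFieldType) (F : fieldExtType K).

Local Notation ext A := (map_mx (in_alg F) A).
Local Notation q := #|K|.
Local Notation m := (\dim {:F}).

Lemma card_finvect : #|finvect_type F| = (q ^ m)%N.
Proof.
pose V : vectType K := finvect_type F.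
by have := @card_vspace K V (Vector.class V) fullv; rewrite card_vspacef.
Qed.

Lemma card_annihilator k r (T : 'M[F]_(k, r)) :
  #|[set x : 'rV[finvect_type F]_k | x *m T == 0]| = ((q ^ m) ^ (k - \rank T))%N.
Proof. by rewrite -card_finvect -card_left_kernel. Qed.

(** The number of coordinate vectors over K whose combination of the columns of
    H lies on the hyperplane of equation x: the size of a hyperplane section of
    the K-span of the columns, when these are K-independent. *)
Definition weight k n (H : 'M[F]_(k, n)) (x : 'rV[F]_k) : nat :=
  #|[set a : 'cV[K]_n | x *m H *m ext a == 0]|.

(** Writing each entry of x *m H in a K-basis of F turns one linear equation
    over F into a linear system over K. *)
Lemma weight_is_power k n (H : 'M[F]_(k, n)) x : exists d, weight H x = (q ^ d)%N.
Proof.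
rewrite /weight; move: (x *m H) => {x H}c.
pose E := \matrix_(j < n, i < m) coord (vbasis {:F}) i (c 0 j).
exists (n - \rank E^T)%N; rewrite -card_right_kernel; apply: eq_card => a.
rewrite !inE -[in RHS]trmx_eq0 trmx_mul trmxK.
have -> : a^T *m E = \row_i coord (vbasis {:F}) i ((c *m ext a) 0 0).
  apply/rowP=> i; have -> : (c *m ext a) 0 0 = \sum_j c 0 j * ext a j 0.
    by rewrite mxE.
  rewrite [LHS]mxE [RHS]mxE raddf_sum; apply: eq_bigr => j _.
  by rewrite !mxE mulr_algr; apply/esym/linearZ.
apply/eqP/eqP=> [->|e]; first by apply/rowP=> i; rewrite !mxE linear0.
apply/matrixP=> i j; rewrite !ord1 (coord_vbasis (memvf ((c *m ext a) 0 0))).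
rewrite [RHS]mxE big1 // => h _; have := congr1 (fun M : 'rV_m => M 0 h) e.
by rewrite !mxE => ->; rewrite scale0r.
Qed.

(** The word y *m ext M is annihilated by the right kernel of M, which has
    dimension at least n - r over K. *)
Lemma weight_ge k n r (H : 'M[F]_(k, n)) x (y : 'rV[F]_r) (M : 'M[K]_(r, n)) :
  x *m H = y *m ext M -> (q ^ (n - r) <= weight H x)%N.
Proof.
move=> xH; apply: (@leq_trans (q ^ (n - \rank M))).
  by rewrite leq_exp2l ?finNzRing_gt1 // leq_sub2l // rank_leq_row.
rewrite -card_right_kernel subset_leq_card //; apply/subsetP => a.
by rewrite !inE xH -mulmxA -map_mxM => /eqP ->; rewrite map_mx0 mulmx0.
Qed.

Section Scattered.

Variables (l : nat) (H : 'M[F]_(2 * l, l * m)).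
Hypothesis l_gt0 : (0 < l)%N.
Hypothesis scatH : forall M : 'M[K]_(l * m, 2), \rank (H *m ext M) = \rank M.

Local Notation N := (l * m)%N.
Local Notation Q := (q ^ m)%N.

Let zero_at (x : 'rV[finvect_type F]_(2 * l)) (a : 'cV[K]_N) : bool :=
  (x : 'rV[F]_(2 * l)) *m H *m ext a == 0.

Let weightE (x : 'rV[finvect_type F]_(2 * l)) :
  weight H x = (\sum_a zero_at x a)%N.
Proof. by rewrite /weight -sum1dep_card big_mkcond. Qed.

(** Summing over x and a after fixing b: a pair (a, b) of K-rank r spans an
    F-space of dimension r, on which Q ^ (2l - r) linear forms x vanish. *)
Let pair_sum (b : 'cV[K]_N) :
  (\sum_x \sum_a (zero_at x b && zero_at x a) =
   q ^ \rank b * Q ^ (2 * l - \rank b) +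
   (q ^ N - q ^ \rank b) * Q ^ (2 * l - (\rank b).+1))%N.
Proof.
pose below (a : 'cV[K]_N) := (a^T <= b^T)%MS.
rewrite exchange_big /=.
have E a : (\sum_x (zero_at x b && zero_at x a) =
    Q ^ (2 * l - (\rank b + ~~ below a)))%N.
  rewrite -(mxrank_tr b) -rank_col_mx_row -tr_row_mx mxrank_tr.
  have <- : \rank (H *m ext (row_mx a b)) = \rank (row_mx a b) := scatH _.
  rewrite -card_annihilator -sum1dep_card [RHS]big_mkcond; apply: eq_bigr => x _ /=.
  congr (if _ then _ else _).
  by rewrite /zero_at map_row_mx !mul_mx_row row_mx_eq0 !mulmxA andbC.
rewrite (eq_bigr _ (fun a _ => E a)) (bigID below) /=.
have card_below : #|[set a | below a]| = (q ^ \rank b)%N.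
  rewrite -(mxrank_tr b) -card_rowg -(card_imset _ trmx_inj).
  apply: eq_card => x; rewrite inE; apply/imsetP/idP => [[a + ->]|xb].
    by rewrite inE.
  by exists x^T; rewrite ?trmxK // inE /below trmxK.
congr (_ + _)%N.
  rewrite (eq_bigr (fun=> Q ^ (2 * l - \rank b))%N) => [|a ->]; last first.
    by rewrite addn0.
  by rewrite sum_nat_const -card_below cardsE.
rewrite (eq_bigr (fun=> Q ^ (2 * l - (\rank b).+1))%N) => [|a ->]; last first.
  by rewrite addn1.
rewrite sum_nat_const; congr (_ * _)%N.
have <- : #|{: 'cV[K]_N}| = (q ^ N)%N by rewrite card_mx muln1.
by rewrite -card_below cardsE -(cardC below) addKn.
Qed.

(** A maximum scattered system meets every hyperplane in codimension m or m - 1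
    over K, the upper bound on the intersection being the part used later. With
    B = q^(N - m), the first two moments of the weight over all x give that the
    sum of (w(x) - B) (w(x) - q B) over x <> 0 is zero. Every term is
    nonnegative, because w(x) is a power of q and no power of q lies strictly
    between B and q B; so every term is zero. *)
Lemma hyperplane_weight (x : 'rV[F]_(2 * l)) :
  x != 0 -> (weight H x <= q ^ (N - m).+1)%N.
Proof.
pose B := (q ^ (N - m))%N; pose FF := finvect_type F.
pose A := (q ^ N)%N.
have q_gt1 : (1 < q)%N := finNzRing_gt1 K.
have mN : (m <= N)%N by rewrite leq_pmull.
have QB : (Q * B = A)%N by rewrite -expnD subnKC.
have A_gt0 : (0 < A)%N by rewrite expn_gt0 ltnW.
have qA : (q <= A)%N.
  by rewrite -{1}(expn1 q) leq_exp2l // (leq_trans _ mN) // adim_gt0.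
have Q0 : (Q ^ (2 * l) = A * A)%N by rewrite -!expnM -expnD; congr (_ ^ _)%N; lia.
have Q1 : (Q ^ (2 * l - 1) = A * B)%N.
  by rewrite -!expnM -expnD; congr (_ ^ _)%N; nia.
have Q2 : (Q ^ (2 * l - 2) = B * B)%N.
  by rewrite -!expnM -expnD; congr (_ ^ _)%N; nia.
have S0 : \sum_(x : 'rV[FF]_(2 * l)) 1 = (A * A)%N :> nat.
  by rewrite sum1_card card_mx mul1n card_finvect.
(* A pair with b = 0 is the single vector a, so the first moment is a
   special case of the pair count. *)
have S1 : (\sum_(x : 'rV[FF]_(2 * l)) weight H x = A * A + (A - 1) * (A * B))%N.
  transitivity (\sum_x \sum_a (zero_at x 0 && zero_at x a))%N.
    apply: eq_bigr => y _; rewrite weightE; apply: eq_bigr => a _.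
    by rewrite {2}/zero_at map_mx0 mulmx0 eqxx.
  by rewrite pair_sum mxrank0 subn0 Q0 Q1 mul1n.
have S2 : (\sum_(x : 'rV[FF]_(2 * l)) weight H x ^ 2 =
    A * A + (A - 1) * (A * B) +
    (A - 1) * (q * (A * B) + (A - q) * (B * B)))%N.
  transitivity (\sum_b \sum_x \sum_a (zero_at x b && zero_at x a))%N.
    rewrite exchange_big; apply: eq_bigr => y _; rewrite weightE.
    rewrite -mulnn big_distrl; apply: eq_bigr => b _; rewrite big_distrr.
    by apply: eq_bigr => a _; apply: mulnb.
  rewrite (bigD1 0) //= pair_sum mxrank0 subn0 Q0 Q1 mul1n; congr (_ + _)%N.
  rewrite (eq_bigr (fun=> q * (A * B) + (A - q) * (B * B)))%N => [|b b0].
    rewrite sum_nat_const; congr (_ * _)%N.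
    by rewrite cardC1 card_mx muln1 subn1.
  rewrite pair_sum (_ : \rank b = 1)%N ?Q1 ?Q2 //; apply/eqP.
  by rewrite eqn_leq rank_leq_col lt0n mxrank_eq0.
pose t (x : 'rV[FF]_(2 * l)) : int :=
  ((weight H x)%:R - B%:R) * ((weight H x)%:R - (q * B)%:R).
have t_ge0 y : 0 <= t y.
  rewrite /t -expnS; have [d ->] := weight_is_power H y.
  have [dB|Bd] := leqP d (N - m).
    by rewrite mulr_le0 // subr_le0 ler_nat leq_exp2l // ltnW.
  by rewrite mulr_ge0 // subr_ge0 ler_nat leq_exp2l // ltnW.
have t0 : \sum_(y | y != 0) t y = 0.
  (* The zero equation vanishes on all of W and contributes the single
     term that has to be removed from the moments. *)
  have w0 : weight H (0 : 'rV[FF]_(2 * l)) = A.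
    rewrite /A -[X in (q ^ X)%N]muln1 -(card_mx K) -cardsT; apply: eq_card => a.
    by rewrite !inE !mul0mx eqxx.
  have : \sum_y t y = (\sum_(y : 'rV[FF]_(2 * l)) weight H y ^ 2)%N%:R -
      (1 + q%:R) * B%:R * (\sum_(y : 'rV[FF]_(2 * l)) weight H y)%N%:R +
      q%:R * B%:R ^+ 2 * (\sum_(y : 'rV[FF]_(2 * l)) 1)%N%:R.
    rewrite !natr_sum !mulr_sumr -sumrB -big_split; apply: eq_bigr => y _ /=.
    by rewrite /t (natrX _ (weight H y)) natrM; ring.
  rewrite (bigD1 0) //= {1}/t w0 S0 S1 S2 !(natrD, natrM).
  rewrite (natrB _ A_gt0) (natrB _ qA).
  move=> e; apply: (addrI ((A%:R - B%:R) * (A%:R - q%:R * B%:R))).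
  by rewrite e; ring.
move=> x0; have /(_ x x0)/eqP := psumr_eq0P (fun y _ => t_ge0 y) t0.
rewrite mulf_eq0 !subr_eq0 !eqr_nat => /orP[]/eqP->; last by rewrite expnS.
by rewrite leq_exp2l.
Qed.

End Scattered.
End HyperplaneWeights.

(** * Scattered systems and rank distance *)

Section Scatteredness.

Variables (K : finFieldType) (F : fieldExtType K).

Local Notation ext A := (map_mx (in_alg F) A).

Lemma mulmx_sum_col k n (T : 'M[F]_(k, n)) (c : 'cV[F]_n) :
  T *m c = \sum_j c j 0 *: col j T.
Proof.
apply/matrixP=> i j; rewrite ord1 summxE mxE.
by apply: eq_bigr => h _; rewrite !mxE mulrC.
Qed.

(** If two K-independent combinations of the columns were proportional over F,
    the F-line through them would meet the system in K-dimension 2. *)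
Lemma scattered_pair_rank k n (G : 'M[F]_(k, n)) :
    free (columns G) -> is_scattered 1 (column_span G) ->
  forall M : 'M[K]_(n, 2), \rank (G *m ext M) = \rank M.
Proof.
move=> /free_columnsP fG scG M; apply/eqP.
rewrite eqn_leq -{1}(mxrank_map (in_alg F)).
rewrite mxrankM_maxr leqNgt /=; apply/negP=> ltr.
set T := G *m ext M in ltr.
have T0 : T != 0.
  apply/eqP=> T0; move: ltr; rewrite T0 mxrank0 lt0n mxrank_eq0 => /negP[].
  rewrite -trmx_eq0; apply/eqP/row_matrixP=> j; rewrite row0 -tr_col.
  rewrite (fG (col j M)) ?trmx0 // map_col colE mulmxA -/T T0.
  by rewrite mul0mx.
have rT : \rank T = 1%N.
  apply/eqP; rewrite eqn_leq lt0n mxrank_eq0 T0 andbT -ltnS.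
  exact: leq_trans ltr (rank_leq_col M).
have rM : \rank M = 2 
  by apply/eqP; rewrite eqn_leq rank_leq_col; move: ltr; rewrite rT.
have [j uT] : exists j, col j T != 0.
  apply/existsP; apply: contraNT T0; rewrite negb_exists => /forallP Tj.
  rewrite -trmx_eq0; apply/eqP/row_matrixP=> j; rewrite row0 -tr_col.
  by move: (Tj j); rewrite negbK => /eqP->; rewrite trmx0.
pose L := <[col j T]>%VS.
have TT : (T^T <= row j T^T)%MS.
  rewrite -(mxrank_leqif_sup (row_sub j T^T)).2 mxrank_tr rT eqn_leq.
  by rewrite rank_leq_row lt0n mxrank_eq0 -tr_col trmx_eq0 uT.
have colL i : col i T \in L.
  have /sub_rVP[a] := submx_trans (row_sub i T^T) TT.
  rewrite -!tr_col => /(congr1 trmx); rewrite linearZ /= !trmxK => ->.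
  exact: (memvZ _ (memv_line _)).
have dL : \dim L = 1%N by rewrite dim_vline uT.
have fT : free (columns T).
  apply/free_columnsP=> y; rewrite -mulmxA -map_mxM => /fG My0.
  exact: injective_of_rank rM My0.
suff sTL : (column_span T <= column_span G :&: restrict_scalars L)%VS.
  by have := leq_trans (dimvS sTL) (scG L dL); rewrite dim_column_span.
apply/subvP=> _ /mem_column_span[y ->]; rewrite memv_cap mem_restrict_scalars.
apply/andP; split.
  by apply/mem_column_span; exists (M *m y); rewrite map_mxM mulmxA.
by rewrite mulmx_sum_col; apply: memv_suml => i _; apply/memvZ/colL.
Qed.

(** An h-dimensional L meeting the system in K-dimension at least h + 1 would
    contain h + 1 K-independent vectors of the system, and these would be
    F-independent. *)
Lemma scattered_of_independence k n h (G : 'M[F]_(k, n)) :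
    (forall (M : 'M[K]_(n, h.+1)) (c : 'cV[F]_h.+1),
       \rank M = h.+1 -> G *m ext M *m c = 0 -> c = 0) ->
  is_scattered h (column_span G).
Proof.
move=> indG L dL; rewrite leqNgt; apply/negP; set UL := (_ :&: _)%VS => hUL.
pose T : 'M[F]_(k, h.+1) := \matrix_(i, j) ((vbasis UL)`_j : 'cV[F]_k) i 0.
have colT j : (col j T : colvec F k) = (vbasis UL)`_j.
  by apply/matrixP=> a b; rewrite !mxE ord1.
have memT j : (col j T : colvec F k) \in UL.
  by rewrite colT vbasis_mem // mem_nth // size_tuple (leq_trans (ltn_ord j)).
have [M TM] : exists M : 'M[K]_(n, h.+1), T = G *m ext M.
  by apply: column_span_factor => j; move: (memT j); rewrite memv_cap => /andP[].
have fT : free (columns T).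
  have : free (take h.+1 (vbasis UL)).
    have := basis_free (vbasisP UL).
    by rewrite -{1}(cat_take_drop h.+1 (vbasis UL)) => /catl_free.
  congr free; apply: (@eq_from_nth _ 0).
    by rewrite size_takel ?size_tuple.
  rewrite size_takel ?size_tuple // => i ih; rewrite nth_take //.
  by rewrite (nth_columns T (Ordinal ih)) colT.
have rM : \rank M = h.+1.
  apply: rank_of_injective => y My0; move/free_columnsP: fT; apply.
  by rewrite TM -mulmxA -map_mxM My0 map_mx0 mulmx0.
pose X := [tuple col j T | j < h.+1].
have : free X.
  apply/freeP=> c c0 i.
  have /matrixP/(_ i 0) : \col_i c i = 0.
    apply: (indG M) => //; rewrite -TM mulmx_sum_col -[RHS]c0.
    by apply: eq_bigr => j _; rewrite mxE -tnth_nth tnth_mktuple.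
  by rewrite !mxE.
rewrite /free size_tuple => /eqP dX.
suff : (<<X>> <= L)%VS by move/dimvS; rewrite dX dL ltnn.
apply/span_subvP=> _ /tnthP[j ->]; rewrite tnth_mktuple.
by have := memT j; rewrite memv_cap mem_restrict_scalars => /andP[].
Qed.

Lemma spanning_of_row_free k n (G : 'M[F]_(k, n)) (L : {vspace 'cV[F]_k}) :
  row_free G -> (column_span G <= restrict_scalars L)%VS -> L = fullv.
Proof.
move=> fG GL; apply/eqP; rewrite eqEsubv subvf; apply/subvP=> v _.
rewrite -[v]mul1mx -(mulmxVp fG) -mulmxA mulmx_sum_col.
apply: rpred_sum => j _; rewrite rpredZ // -mem_restrict_scalars.
exact: (subvP GL) (col_column_span G j).
Qed.

(** The code with generator matrix H has minimum rank distance at least m - 1: a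
    word of rank weight r vanishes on a subspace of K-codimension r, which for
    r <= m - 2 is more than a hyperplane section of W can contain. *)
Lemma low_rank_codeword_eq0 l r (H : 'M[F]_(2 * l, l * \dim {:F})) x (y : 'rV_r)
    (M : 'M[K]_(r, l * \dim {:F})) :
    (0 < l)%N -> (forall M : 'M[K]_(_, 2), \rank (H *m ext M) = \rank M) ->
    (r.+2 <= \dim {:F})%N ->
  x *m H = y *m ext M -> x = 0.
Proof.
move=> l0 scH rm xH; apply/eqP; apply: contraT => x0.
have := leq_trans (weight_ge xH) (hyperplane_weight l0 scH x0).
rewrite leq_exp2l ?finNzRing_gt1 //.
have : (\dim {:F} <= l * \dim {:F})%N by rewrite leq_pmull.
lia.
Qed.

End Scatteredness.

(** * Duality and equivalence of systems *)

Section Duality.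

Variables (K : fieldType) (F : fieldExtType K).

Local Notation ext A := (map_mx (in_alg F) A).

(** The rows of H lie in the left kernel of G^T, and the two spaces have the
    same dimension n - k = r. *)
Lemma dual_code (L : fieldType) r k n p (H : 'M[L]_(r, n)) (G : 'M[L]_(k, n))
    (v : 'M[L]_(p, n)) :
    row_free H -> row_free G -> H *m G^T = 0 -> (r + k = n)%N ->
  v *m G^T = 0 -> exists X, v = X *m H.
Proof.
move=> /eqnP rH /eqnP rG /sub_kermxP HG rk /sub_kermxP vG; apply/submxP.
apply: submx_trans vG _; rewrite -(mxrank_leqif_sup HG).2.
by rewrite mxrank_ker mxrank_tr rH rG -rk addnK.
Qed.

(** A power map commutes with the embedding of K into F. This is how field
    automorphisms that move elements of K are handled. *)
Lemma map_ext_power n r (sigma : {rmorphism F -> F}) d (M : 'M[K]_(n, r)) :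
    (forall x, sigma x = x ^+ d) ->
  map_mx sigma (ext M) = ext (map_mx (fun a => a ^+ d) M).
Proof.
by move=> sE; apply/matrixP=> i j; rewrite !mxE sE -(rmorphXn (in_alg F)).
Qed.

(** Equivalence passes to dual codes. If U' = B sigma(U), the generator matrices
    satisfy G' = B sigma(G) Y with Y invertible over K, so H' Y^T annihilates
    sigma(G), and its rows are therefore combinations of those of sigma(H). *)
Lemma equivalent_parity_checks r k n (H H' : 'M[F]_(r, n))
    (G G' : 'M[F]_(k, n)) :
    (forall sigma : {rmorphism F -> F}, exists d, forall x, sigma x = x ^+ d) ->
    (r + k = n)%N -> row_free G -> row_free H -> row_free H' ->
    H *m G^T = 0 -> H' *m G'^T = 0 -> free (columns G') ->
    equivalent_systems (column_span G) (column_span G') ->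
  exists (sigma : {rmorphism F -> F}) (B : 'M[F]_r) (P : 'M[K]_n),
    [/\ B \in unitmx, P \in unitmx & H' = B *m map_mx sigma H *m ext P].
Proof.
move=> frob rk fG fH fH' HG HG' freeG' [B [sigma [uB _ GG']]].
have [d sE] := frob sigma.
have [Y G'E] : exists Y : 'M[K]_n, G' = B *m map_mx sigma G *m ext Y.
  apply: column_span_factor => j; apply/mem_column_span.
  have /GG'[u /mem_column_span[y ->] ->] := col_column_span G' j.
  by exists (map_mx (fun a => a ^+ d) y); rewrite map_mxM (map_ext_power _ sE)
    mulmxA.
have uY : Y \in unitmx.
  rewrite -unitmx_tr -row_free_unit /row_free mxrank_tr; apply/eqP.
  apply: rank_of_injective => y Yy0; move/free_columnsP: freeG'; apply.
  by rewrite G'E -mulmxA -map_mxM Yy0 map_mx0 mulmx0.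
have [||||X HX] := @dual_code F r k n r (map_mx sigma H) (map_mx sigma G)
  (H' *m ext Y^T) _ _ _ rk.
- by rewrite row_free_map.
- by rewrite row_free_map.
- by rewrite map_trmx -map_mxM HG map_mx0.
- have uBT : B^T \in unitmx by rewrite unitmx_tr.
  rewrite -[LHS](mulmxK uBT) -[RHS](mul0mx _ (invmx B^T)) -HG' G'E.
  by rewrite !trmx_mul -!map_trmx !mulmxA.
exists sigma, X, (invmx Y^T); split.
- rewrite -row_free_unit /row_free eqn_leq rank_leq_row /=.
  rewrite -{1}(eqnP fH') -(mxrankMfree H' (B := ext Y^T)).
    by rewrite HX mxrankM_maxl.
  by rewrite row_free_map row_free_unit unitmx_tr.
- by rewrite unitmx_inv unitmx_tr.
- by rewrite -HX -mulmxA -map_mxM mulmxV ?unitmx_tr // map_mx1 mulmx1.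
Qed.

Lemma equivalent_systems_sym k (U U' : {vspace (colvec F k)}) :
  equivalent_systems U U' -> equivalent_systems U' U.
Proof.
case=> B [sigma [uB [tau sK tK] UU']].
have tA : zmod_morphism tau := can2_zmod_morphism sK tK.
have tM : monoid_morphism tau := can2_monoid_morphism sK tK.
pose tauA := GRing.isZmodMorphism.Build _ _ tau tA.
pose tauM := GRing.isMonoidMorphism.Build _ _ tau tM.
pose tauR : {rmorphism F -> F} := HB.pack tau tauA tauM.
have back u : map_mx tauR (invmx B) *m map_mx tauR (B *m map_mx sigma u) = u.
  rewrite -map_mxM mulKmx // -map_mx_comp; apply/matrixP=> i j.
  by rewrite mxE /= sK.
exists (map_mx tauR (invmx B)), tauR; split.
- by rewrite map_unitmx unitmx_inv.
- by exists sigma.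
move=> v; split=> [vU|[u /UU'[w wU ->] ->]]; last by rewrite back.
by exists (B *m map_mx sigma v); [apply/UU'; exists v | rewrite back].
Qed.

Section ExtendedSystem.

Variables (k n s : nat) (G : 'M[F]_(k, n)).

(** The matrix whose columns are the (g_j, phi(g_j)) and the (0, e_i): an
    F_q-basis of U_phi when Phi is the matrix of phi. *)
Definition extended_generator (Phi : 'M[F]_(s, n)) : 'M[F]_(k + s, n + s) :=
  block_mx G 0 Phi 1%:M.

Lemma extended_generator_parity r (H : 'M[F]_(r, n)) (Phi : 'M[F]_(s, n)) :
  H *m G^T = 0 ->
  row_mx H (- (H *m Phi^T)) *m (extended_generator Phi)^T = 0.
Proof.
move=> HG; rewrite tr_block_mx trmx1 trmx0 mul_row_block HG mulmx0 mulmx1 addr0.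
by rewrite subrr row_mx0.
Qed.

Lemma row_free_extended_generator (Phi : 'M[F]_(s, n)) :
  row_free G -> row_free (extended_generator Phi).
Proof.
move=> fG; rewrite -kermx_eq0; apply/eqP/row_matrixP=> i; rewrite row0.
have := row_mul i (kermx (extended_generator Phi)) (extended_generator Phi).
rewrite mulmx_ker row0; set v := row i _.
rewrite -(hsubmxK v) mul_row_block mulmx0 add0r mulmx1 -row_mx0.
move/esym/eq_row_mx => [e1 e2]; move: e1; rewrite e2 mul0mx addr0 => e1.
by rewrite (row_free_inj fG (etrans e1 (esym (mul0mx _ _)))) row_mx0.
Qed.

Lemma free_extended_generator (Phi : 'M[F]_(s, n)) :
  free (columns G) -> free (columns (extended_generator Phi)).
Proof.
move/free_columnsP=> fG; apply/free_columnsP=> y.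
rewrite -[y]vsubmxK map_col_mx mul_block_col mul0mx addr0 mul1mx -col_mx0.
case/eq_col_mx => /fG -> ; rewrite map_mx0 mulmx0 add0r => e2.
suff -> : dsubmx y = 0 by rewrite ?col_mx0.
apply/matrixP=> i j; move/matrixP/(_ i j)/eqP: e2.
by rewrite !mxE fmorph_eq0 => /eqP.
Qed.

Lemma phi_mulmx_ext (phi : 'Hom(subvs_of (column_span G), colvec F s))
    (u : subvs_of (column_span G)) y :
  (vsval u : 'cV[F]_k) = G *m ext y ->
  (phi u : 'cV[F]_s) = Phi_mx phi *m ext y.
Proof.
move=> uy; rewrite mulmx_ext.
have -> : u = \sum_j y j 0 *: vsproj (column_span G) (col j G : colvec F k).
  apply: subvs_inj; rewrite [LHS]uy mulmx_ext linear_sum.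
  apply: eq_bigr => j _; rewrite nth_columns linearZ /= vsprojK //.
  exact: col_column_span.
rewrite linear_sum; apply: eq_bigr => j _; rewrite nth_columns linearZ /=.
by congr (_ *: _); apply/matrixP=> a b; rewrite !mxE ord1.
Qed.

Lemma U_phi_column_span (phi : 'Hom(subvs_of (column_span G), colvec F s)) :
  U_phi phi = column_span (extended_generator (Phi_mx phi)).
Proof.
apply/vspaceP=> v; apply/idP/mem_column_span.
  move=> /mem_U_phi[u [a ->]].
  have /mem_column_span[y uy] := subvsP u.
  exists (col_mx y a); rewrite map_col_mx mul_block_col mul0mx addr0 mul1mx.
  by rewrite (phi_mulmx_ext phi uy) uy.
case=> y ->; apply/mem_U_phi.
have Gy : (G *m ext (usubmx y) : colvec F k) \in column_span G.
  by apply/mem_column_span; exists (usubmx y).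
exists (Subvs Gy), (dsubmx y).
rewrite (@phi_mulmx_ext phi (Subvs Gy) (usubmx y)) //.
rewrite -[in LHS](vsubmxK y) map_col_mx mul_block_col mul0mx addr0 mul1mx.
by [].
Qed.

Lemma Phi_mx_surj (Phi : 'M[F]_(s, n)) : free (columns G) ->
  exists phi : 'Hom(subvs_of (column_span G), colvec F s), Phi_mx phi = Phi.
Proof.
move=> fG; have [f Df] := linear_of_free (columns G) (columns Phi).
have /(_ fG) := Df; rewrite !size_tuple => /(_ erefl) {}Df.
exists (linfun (f \o vsval)); apply/matrixP=> i j; rewrite mxE lfunE /=.
rewrite vsprojK ?col_column_span //.
have := congr1 (fun t => (nth 0 t j : 'cV[F]_s) i 0) Df.
rewrite (nth_map 0) ?size_tuple // !nth_columns => ->.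
by rewrite mxE.
Qed.

End ExtendedSystem.

(** Independence of the columns of (H | Z) says that the span of Z has dimension
    s and meets W trivially, so that it embeds into the quotient by W. *)
Lemma dim_E_bar r n s (H : 'M[F]_(r, n)) (Z : 'M[F]_(r, s)) :
    free (columns (row_mx H Z)) ->
  \dim (E_bar (column_span H) Z) = s.
Proof.
move/free_columnsP=> fHZ; rewrite /E_bar -limg_span limg_dim_eq.
  apply: dim_column_span; apply/free_columnsP=> z Zz.
  have /fHZ : row_mx H Z *m ext (col_mx 0 z) = 0.
    by rewrite map_col_mx map_mx0 mul_row_col mulmx0 add0r.
  by rewrite -col_mx0 => /eq_col_mx[].
apply/eqP; rewrite -subv0; apply/subvP=> v.
rewrite memv_cap lker_quotv_proj memv0.
case/andP=> /mem_column_span[z ->] /mem_column_span[y Zz].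
have /fHZ : row_mx H Z *m ext (col_mx y (- z)) = 0.
  by rewrite map_col_mx map_mxN mul_row_col mulmxN Zz subrr.
rewrite -col_mx0 => /eq_col_mx[_ /eqP]; rewrite oppr_eq0 => /eqP ->.
by apply/eqP; rewrite map_mx0 mulmx0.
Qed.

End Duality.

(** * Systems equivalent to a given one *)

Section Neighbourhoods.

Variables (K : finFieldType) (F : fieldExtType K).
Variables (r n s d p : nat) (H : 'M[F]_(r, n)) (C : 'M[F]_(r, n)).

Local Notation ext A := (map_mx (in_alg F) A).
Local Notation FF := (finvect_type F).

Hypothesis freeHC : free (columns (row_mx H C)).

(** Let W be the K-span of the columns of H. The columns of C span a complement
    of W, and the rows of A are coordinates
    in that complement; the row space of A stands for an s-dimensional subspace
    of the quotient by W. *)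
Definition combination_mx (A : 'M[K]_(s, n)) : 'M[F]_(r, s) := C *m ext A^T.
Definition parity_mx (A : 'M[K]_(s, n)) : 'M[F]_(r, n + s) :=
  row_mx H (combination_mx A).

Lemma free_parity_mx A : row_free A -> free (columns (parity_mx A)).
Proof.
move=> fA; move/free_columnsP: freeHC => fHC; apply/free_columnsP=> y.
rewrite -[y]vsubmxK map_col_mx mul_row_col /combination_mx -mulmxA -map_mxM.
move=> e; have /fHC : row_mx H C *m ext (col_mx (usubmx y) (A^T *m dsubmx y)) = 0.
  by rewrite map_col_mx mul_row_col.
rewrite -col_mx0 => /eq_col_mx[-> e2]; suff -> : dsubmx y = 0 by rewrite ?col_mx0.
by apply: injective_of_rank e2; rewrite mxrank_tr (eqnP fA).
Qed.

(** The K-span of the columns for A' lies in the one for A. Comparing the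
    coordinates along the columns of C, which are those modulo W, gives
    A' = S A; since A' has full row rank, S is invertible. *)
Lemma parity_mx_ext_eq A A' (P : 'M[K]_(n + s)) :
  row_free A' -> parity_mx A' = parity_mx A *m ext P ->
  exists2 S : 'M[K]_s, S \in unitmx & A' = S *m A.
Proof.
move=> fA' e; have eA : A'^T = A^T *m drsubmx P.
  have : row_mx H C *m
      ext (col_mx (- ursubmx P) (A'^T - A^T *m drsubmx P)) = 0.
    move: e; rewrite -[P]submxK map_block_mx mul_row_block => /eq_row_mx[_].
    rewrite submxK /combination_mx -mulmxA -map_mxM => e.
    rewrite map_col_mx mul_row_col map_mxN mulmxN map_mxB mulmxBr e.
    by rewrite addrK addNr.
  move/(mulmx_ext_eq0 freeHC); rewrite -col_mx0 => /eq_col_mx[_ /eqP].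
  by rewrite subr_eq0 => /eqP.
have e' : A' = (drsubmx P)^T *m A by apply: trmx_inj; rewrite trmx_mul trmxK.
exists (drsubmx P)^T => //; rewrite -row_free_unit /row_free eqn_leq.
by rewrite rank_leq_row -{1}(eqnP fA') e' mxrankM_maxl.
Qed.

(** The exponent p ^ j ranges over the field automorphisms of F when d = em. *)
Definition neighbours (A : 'M[K]_(s, n)) : {set 'M[K]_(s, n)} :=
  [set A' | row_free A' & [exists j : 'I_d, exists B : 'M[FF]_r,
    exists P : 'M[K]_(n + s), [&& B \in unitmx, P \in unitmx &
      parity_mx A' ==
        B *m map_mx (fun x : F => x ^+ (p ^ j)) (parity_mx A) *m ext P]]].

(** For a fixed automorphism and a fixed B, the condition determines the column
    span of parity_mx A', hence A' up to GL_s(K). *)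
Lemma card_neighbours A : (0 < r)%N ->
  (#|neighbours A| <= d * #|'GL_r[FF]%g| * \prod_(i < s) (#|K| ^ s - #|K| ^ i))%N.
Proof.
move=> r0; rewrite -card_unitmx // -(card_row_free K s s).
pose fib (jB : 'I_d * 'M[FF]_r) : {set 'M[K]_(s, n)} :=
  [set A' | row_free A' & [exists P : 'M[K]_(n + s), (P \in unitmx) &&
     (parity_mx A' ==
        jB.2 *m map_mx (fun x : F => x ^+ (p ^ jB.1)) (parity_mx A) *m ext P)]].
pose D := setX [set: 'I_d] [set B : 'M[FF]_r | B \in unitmx].
have sub : neighbours A \subset \bigcup_(jB in D) fib jB.
  apply/subsetP=> A'; rewrite inE => /andP[fA' /existsP[j /existsP[B /existsP[P]]]].
  case/and3P=> uB uP e; apply/bigcupP; exists (j, B); first by rewrite !inE.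
  by rewrite inE fA'; apply/existsP; exists P; rewrite uP.
apply: leq_trans (subset_leq_card sub) _.
have -> : (d * #|[set B : 'M[FF]_r | B \in unitmx]| = #|D|)%N.
  by rewrite cardsX cardsT card_ord.
rewrite -sum_nat_const; apply: leq_trans (_ : \sum_(jB in D) #|fib jB| <= _)%N.
  elim/big_rec2: _ => [|jB u S _ IH]; first by rewrite cards0.
  by apply: leq_trans (leq_card_setU _ _).1 _; rewrite leq_add2l.
apply: leq_sum => -[j B] _; have [->|[A1 fA1]] := set_0Vmem (fib (j, B)).
  by rewrite cards0.
apply: leq_trans (leq_imset_card (fun S : 'M[K]_s => S *m A1) _).
apply: subset_leq_card; apply/subsetP=> A'.
rewrite inE => /andP[fA' /existsP[P' /andP[uP' /eqP e']]].
move: fA1; rewrite inE => /andP[_ /existsP[P1 /andP[uP1 /eqP e1]]].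
have [|S uS ->] := @parity_mx_ext_eq A1 A' (invmx P1 *m P') fA'.
  by rewrite e' e1 -[RHS]mulmxA -map_mxM mulKVmx.
by apply/imsetP; exists S; rewrite // inE row_free_unit.
Qed.

End Neighbourhoods.

Lemma dim_colvec (K : fieldType) (F : fieldExtType K) r :
  \dim {:colvec F r} = (r * \dim {:F})%N.
Proof. by rewrite !dimvf. Qed.

Lemma complement_columns (K : fieldType) (F : fieldExtType K) r n
    (H : 'M[F]_(r, n)) :
    free (columns H) -> (n + n = r * \dim {:F})%N ->
  exists C : 'M[F]_(r, n), free (columns (row_mx H C)).
Proof.
move=> fH nn; set W := column_span H; set X := vbasis W^C.
have dX : \dim W^C = n.
  by rewrite dimv_compl dim_colvec dim_column_span // -nn addnK.
pose C : 'M[F]_(r, n) := \matrix_(i, j) (X`_j : 'cV[F]_r) i 0.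
have colC : columns C = X :> seq _.
  apply: (@eq_from_nth _ 0); rewrite !size_tuple // => i ltin.
  rewrite (nth_columns C (Ordinal ltin)).
  by apply/matrixP=> a b; rewrite !mxE ord1.
have fC : free (columns C) by rewrite colC (basis_free (vbasisP _)).
have spC : column_span C = (W^C)%VS.
  by rewrite /column_span colC (span_basis (vbasisP _)).
exists C; apply/free_columnsP=> y.
rewrite -[y]vsubmxK map_col_mx mul_row_col => /eqP; rewrite addr_eq0 => /eqP e.
have Cy0 : C *m map_mx (in_alg F) (dsubmx y) = 0.
  apply/eqP; rewrite -oppr_eq0 -e.
  have : (H *m map_mx (in_alg F) (usubmx y) : colvec F r) \in (W :&: W^C)%VS.
    rewrite memv_cap; apply/andP; split.
      by apply/mem_column_span; exists (usubmx y).
    rewrite -spC; apply/mem_column_span; exists (- dsubmx y).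
    by rewrite map_mxN mulmxN.
  by rewrite capv_compl memv0.
rewrite (mulmx_ext_eq0 fC Cy0).
move: e; rewrite Cy0 oppr0 => /(mulmx_ext_eq0 fH) ->.
by rewrite ?col_mx0.
Qed.

(** * The extended systems are extremal *)

Section ExtremalSystems.

Variables (K : finFieldType) (F : fieldExtType K) (l s : nat).

Local Notation ext A := (map_mx (in_alg F) A).
Local Notation m := (\dim {:F}).

Variables (H : 'M[F]_(2 * l, l * m)) (G : 'M[F]_(l * (m - 2), l * m)).

Hypothesis l_gt0 : (0 < l)%N.
Hypothesis m_ge3 : (3 <= m)%N.
Hypothesis s_small : (2 * s < m - 2)%N.
Hypothesis scatH : forall M : 'M[K]_(l * m, 2), \rank (H *m ext M) = \rank M.
Hypothesis freeG : row_free G.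
Hypothesis HG : H *m G^T = 0.

(** A relation between the rows of H is a zero word x H, of rank weight 0. *)
Lemma row_free_scattered : row_free H.
Proof.
rewrite -kermx_eq0; apply/eqP/row_matrixP=> i; rewrite row0.
apply: (@low_rank_codeword_eq0 _ _ l 0 H _ 0 0) => //; first exact: ltnW.
by rewrite mul0mx -row_mul mulmx_ker row0.
Qed.

(** A K-relation between the columns of G is a word of rank weight at most 1 in
    the code of H. *)
Lemma free_columns_dual : free (columns G).
Proof.
apply/free_columnsP=> y Gy.
have [||x xH] := @dual_code F _ _ _ 1 H G (ext y^T) row_free_scattered freeG HG.
- by rewrite mulnC -mulnDr subnKC // ltnW.
- by apply: trmx_inj; rewrite trmx_mul map_trmx !trmxK Gy trmx0.
have x0 : x = 0.
  apply: (@low_rank_codeword_eq0 _ _ l 1 H _ 1%:M y^T) => //.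
  by rewrite -xH mul1mx.
have /eqP : ext y^T = 0 by rewrite xH x0 mul0mx.
by rewrite map_mx_eq0 trmx_eq0 => /eqP.
Qed.

(** A relation with coefficients in F among m - 2 K-independent vectors of U_phi
    is a word of rank weight at most m - 2 in the code with generator matrix
    (H | Z). Its first block is a word x H of no larger rank weight, so x = 0 by
    the minimum distance of the code of H. The bound on s makes lm + s
    the extremal rank. *)
Lemma U_phi_extremal (phi : 'Hom(subvs_of (column_span G), colvec F s)) :
  extremal_scattered (m - 3) (U_phi phi).
Proof.
rewrite U_phi_column_span; set Phi := Phi_mx phi.
have m3 : (m - 3).+1 = (m - 2)%N by lia.
pose Hs := row_mx H (- (H *m Phi^T)).
split; first split.
- rewrite dim_column_span; last exact/free_extended_generator/free_columns_dual.
  (* With d = m - 2, (l d + s) (d + 2) = (l (d + 2) + s) d + 2 s with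
     2 s < d. *)
  rewrite m3; have [d md] : exists d, m = d.+2 by exists (m - 2)%N; lia.
  move: s_small; rewrite md subn2 /= => sd.
  have -> : ((l * d + s) * d.+2 = (l * d.+2 + s) * d + 2 * s)%N by lia.
  by rewrite divnMDl ?divn_small ?addn0 //; lia.
- by move=> L; apply/spanning_of_row_free/row_free_extended_generator.
apply: scattered_of_independence => M c rM GMc.
have [|||||x xH] := @dual_code F (2 * l) (l * (m - 2) + s) (l * m + s) 1 Hs
  (extended_generator G Phi) (ext M *m c)^T.
- exact/row_free_row_mx/row_free_scattered.
- exact: row_free_extended_generator.
- exact: extended_generator_parity.
- by rewrite addnA mulnC -mulnDr subnKC // ltnW.
- by rewrite -trmx_mul mulmxA GMc trmx0.
suff x0 : x = 0.
  have /(congr1 trmx) := xH; rewrite x0 mul0mx trmxK trmx0.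
  by apply: injective_of_rank; rewrite mxrank_map.
move: xH; rewrite mul_mx_row trmx_mul map_trmx -[M]vsubmxK tr_col_mx map_row_mx.
rewrite mul_mx_row => /eq_row_mx[xH _].
by apply: (low_rank_codeword_eq0 l_gt0 scatH _ (esym xH)); lia.
Qed.

End ExtremalSystems.

(** * The lower bound *)

Theorem theorem3p3 (p e q m l s : nat) (K : finFieldType) (F : fieldExtType K)
  (p_prime : prime p) (q_def : q = (p ^ e)%N)
  (card_K : #|K| = q) (dim_F : \dim {:F} = m)
  (m_ge5 : (5 <= m)%N) (l_ge1 : (1 <= l)%N)
  (s_ge1 : (1 <= s)%N) (s_lt : s%:R < (m%:R - 2%:R) / 2%:R :> rat)
  (W : {vspace (colvec F (2 * l))}) (W_max : maximum_scattered W)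
  (H0 : 'M[F]_(2 * l, l * m)) (H0_basis : basis_of W (columns H0))
  (G0 : 'M[F]_(l * (m - 2), l * m)) (G0_dual : generates_dual H0 G0) :
  exists (r : nat)
         (phi : 'I_r -> 'Hom(subvs_of (column_span G0), colvec F s)),
    [/\ Num.ceil (gaussian_coef q (l * m) s /
                  (e * m * #|'GL_(2 * l)[finvect_type F]%g|)%:R) <= r%:Z,
        forall i, \dim (E_bar W (Z_mx H0 (phi i))) = s,
        forall i, extremal_scattered (m - 3) (U_phi (phi i)) &
        forall i j, i != j ->
          ~ equivalent_systems (U_phi (phi i)) (U_phi (phi j))].
Proof.
subst m; have m_ge3 : (3 <= \dim {:F})%N by apply: leq_trans m_ge5.
set m := \dim {:F} in m_ge5 m_ge3 *.
have s_small : (2 * s < m - 2)%N.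
  move: s_lt; rewrite ltr_pdivlMr ?ltr0n // -natrB ?(ltnW m_ge3) //.
  by rewrite -natrM ltr_nat mulnC.
have freeH := basis_free H0_basis.
have WE : column_span H0 = W := span_basis H0_basis.
subst W; case: W_max => _ scW.
have scH := scattered_pair_rank freeH scW.
have [fG0 dualG0] := G0_dual.
have HG : H0 *m G0^T = 0.
  apply/matrixP=> i j; have [/(_ (row_sub j G0))/(_ _ (row_sub i H0)) h _] :=
    dualG0 (row j G0).
  have := congr1 (fun M : 'M_1 => M 0 0) h; rewrite !mxE => h'.
  by rewrite -[RHS]h'; apply: eq_bigr => k _; rewrite !mxE.
have fH0 : row_free H0 by apply: row_free_scattered.
have freeG : free (columns G0) by apply: (free_columns_dual _ _ scH).
have [C freeHC] : exists C : 'M[F]_(2 * l, l * m), free (columns (row_mx H0 C)).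
  by apply: complement_columns; rewrite // -mulnA mul2n addnn.
pose T := 'M[K]_(s, l * m).
have /fin_all_exists [phi Dphi] (A : T) :
    exists phi : 'Hom(subvs_of (column_span G0), colvec F s),
      Z_mx H0 phi = combination_mx C A.
  have [phi DPhi] := Phi_mx_surj (- (pinvmx H0 *m combination_mx C A)^T) freeG.
  exists phi; rewrite /Z_mx DPhi linearN /= trmxK mulmxN opprK mulmxA.
  by rewrite mulmxVp // mul1mx.
have cardFF : #|finvect_type F| = (p ^ (e * m))%N.
  by rewrite card_finvect card_K q_def expnM.
have frob (sigma : {rmorphism F -> F}) :
    exists j : 'I_(e * m), forall x, sigma x = x ^+ (p ^ j).
  exact: (@finField_rmorphism_frobenius (finvect_type F) p _ sigma p_prime cardFF).
have q_gt1 : (1 < q)%N by rewrite -card_K finNzRing_gt1.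
have em_gt0 : (0 < e * m)%N.
  rewrite muln_gt0 (leq_trans _ m_ge5) // andbT lt0n.
  by apply: contraTneq q_gt1 => e0; rewrite q_def e0.
(* Neighbourhoods of a row-free A: em automorphisms, |GL(2l, F)| matrices B,
   and the |GL_s(K)| changes of basis of the rows. *)
pose Nb : T -> {set T} := neighbours (e * m) p H0 C.
pose bound := (e * m * #|'GL_(2 * l)[finvect_type F]%g| *
               \prod_(i < s) (#|K| ^ s - #|K| ^ i))%N.
have [||||r [f [card_f f_free f_ineq]]] := @greedy_packing T
  (fun A B => equivalent_systems (U_phi (phi A)) (U_phi (phi B))) Nb bound
  [set A | row_free A].
- by move=> A B; apply: equivalent_systems_sym.
- move=> A; rewrite !inE => fA; rewrite fA /=.
  apply/existsP; exists (Ordinal em_gt0).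
  apply/existsP; exists 1%:M; apply/existsP; exists 1%:M; rewrite !unitmx1 /=.
  rewrite map_mx1 mulmx1 mul1mx; apply/eqP/matrixP=> i j.
  by rewrite [RHS]mxE expn0 expr1.
- move=> A B; rewrite !inE => fA fB; rewrite !U_phi_column_span => AB.
  rewrite fB /=; have parityE A' :
      parity_mx H0 C A' = row_mx H0 (Z_mx H0 (phi A')) by rewrite Dphi.
  have frob' (sigma : {rmorphism F -> F}) : exists d, forall x : F, sigma x = x ^+ d.
    by have [j sj] := frob sigma; exists (p ^ j)%N.
  have rk : (2 * l + (l * (m - 2) + s) = l * m + s)%N.
    by rewrite addnA mulnC -mulnDr subnKC // ltnW.
  have fH (A' : 'M[K]_(s, l * m)) : row_free (parity_mx H0 C A') :=
    row_free_row_mx _ fH0.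
  have HGA A' : parity_mx H0 C A' *m
      (extended_generator G0 (Phi_mx (phi A')))^T = 0.
    by rewrite parityE; apply: extended_generator_parity.
  have [sigma [B0 [P [uB uP e']]]] := equivalent_parity_checks frob' rk
    (row_free_extended_generator _ fG0) (fH A) (fH B) (HGA A) (HGA B)
    (free_extended_generator _ freeG) AB.
  have [j sj] := frob sigma.
  apply/existsP; exists j; apply/existsP; exists B0; apply/existsP; exists P.
  rewrite uB uP /= e'; apply/eqP; congr (_ *m _ *m _).
  by apply/matrixP=> a b; rewrite !mxE sj.
- by move=> A _; rewrite /bound; apply: card_neighbours; rewrite ?muln_gt0.
exists r, (fun i => phi (f i)); split=> [|i|i|i j]; last exact: f_ineq.
- have GL_gt0 : (0 < #|'GL_(2 * l)[finvect_type F]%g|)%N.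
    by apply/card_gt0P; exists 1%g; rewrite inE.
  have den_gt0 : (0 < e * m * #|'GL_(2 * l)[finvect_type F]%g|)%N.
    by rewrite muln_gt0 em_gt0.
  rewrite ceil_le_int ler_pdivrMr ?ltr0n //.
  have span_gt0 : (0 < \prod_(i < s) (q ^ s - q ^ i))%N.
    by rewrite prodn_gt0 // => i; rewrite subn_gt0 ltn_exp2l.
  rewrite -(ler_pM2r (x := (\prod_(i < s) (q ^ s - q ^ i))%N%:R)) ?ltr0n //.
  have sN : (s <= l * m)%N.
    apply: (@leq_trans m); last by rewrite leq_pmull.
    by move: s_small; lia.
  rewrite gaussian_coefE // -[in leLHS]card_K -card_row_free.
  by rewrite -pmulrn -!natrM ler_nat -mulnA -card_K.
- rewrite Dphi dim_E_bar //; apply: free_parity_mx => //.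
  by have := f_free i; rewrite inE.
- by apply: U_phi_extremal.
Qed.
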